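(* $$\sum_{k=1}^\infty\frac{3^k}{k^2\binom{2k}{k}}\left(S_1(k)+\frac{1}{2k}\right)=\frac{\pi^2}{3}\log 3.$$
   Context: $S_1(n):=\sum_{i=1}^n \frac1i$ is the $n$-th harmonic number; $\log$ is the natural logarithm. *)

(* Defs.v *)
(* Standard library real numbers, with Coquelicot for series. *)
From Stdlib Require Import Reals.
From Coquelicot Require Import Coquelicot.

Open Scope R_scope.

(* The sum is empty, hence zero, for n = 0. *)
Definition S1 (n : nat) : R := sum_n_m (fun i : nat => 1 / INR i) 1 n.

(* [Binomial.C] is the real-valued binomial coefficient; the unqualified [C]
   is Coquelicot's type of complex numbers. *)
Definition summand (k : nat) : R :=
  3 ^ k / (INR k ^ 2 * Binomial.C (2 * k) k) * (S1 k + 1 / (2 * INR k)).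

(* Main.v *)
Require Import Defs.
From Stdlib Require Import Reals Lra Lia.
From Coquelicot Require Import Coquelicot.
Open Scope R_scope.

(** Write a_k = 1 / (k^2 C(2k,k)), h_k = S1 k + 1/(2k), and substitute
    z = 4 sin(t)^2 in the two power series A(z) = sum a_k z^k and
    H(z) = sum a_k h_k z^k, both of radius of convergence at least 4.  The value
    wanted is H(3), that is, H at t = pi/3.

    The second derivative in t of a power series in 4 sin(t)^2 is again such a
    series, with coefficients given by a two-term recurrence
    ([is_derive2_PSeries_sin]).  The recurrence for a_k collapses that of A to a
    constant, so that A(4 sin(t)^2) = 2 t^2 ([PSeries_cb_coef]).  For H, the
    difference h_(k+1) - h_k is rational in k, so that the second derivative is
    expressible by A and A', hence elementary ([PSeries_sin_d2_cbh_coef_sin]):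
      12 t cot(t) + 8 t tan(t) - 6 t^2 / sin(t)^2.

    With c(x) and d(x) the integrals from 0 to x of s cot(s) and s^2 cot(s), the
    relation tan(t) = cot(t) - 2 cot(2t) turns the two integrations into
      H(4 sin(t)^2) = 2 d(2t) - 2 d(t) + 8 t c(t) - 4 t c(2t)
    ([PSeries_cbh_coef]).  At t = pi/3 the arguments t and 2t add up to pi.  The
    reflection formulas for c and d ([cotI_reflection]), whose constants come
    from c(pi/2) = (pi/2) log 2 ([cotI1_PI2]), then cancel all values of c and d
    and leave only multiples of log(2 sin(pi/3)) = (log 3)/2 ([harmG_PI3]). *)

(** * Functions with equal derivatives *)

(** Derivatives are required only in the open interval, since the cotangent
    formulas that this serves are singular at 0. *)
Lemma increment_eq (f g df : R -> R) (a b : R) :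
  a <= b ->
  (forall x, a < x < b -> is_derive f x (df x)) ->
  (forall x, a < x < b -> is_derive g x (df x)) ->
  (forall x, a <= x <= b -> continuous f x) ->
  (forall x, a <= x <= b -> continuous g x) ->
  f b - f a = g b - g a.
Proof.
  intros Hab Hf Hg Cf Cg.
  destruct (MVT_gen (fun x => f x - g x) a b (fun _ => 0)) as [c [_ Hc]].
  - intros x; rewrite Rmin_left, Rmax_right by lra; intros Hx.
    replace 0 with (df x - df x) by ring.
    apply (is_derive_minus f g); auto.
  - intros x; rewrite Rmin_left, Rmax_right by lra; intros Hx.
    apply continuity_pt_filterlim.
    apply (continuous_minus f g); auto.
  - lra.
Qed.

(** * The integrals of t cot(t) and t^2 cot(t) *)

(** The continuous extension of t cot(t) to (-pi, pi). *)
Definition xcot (t : R) : R :=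
  if Req_EM_T t 0 then 1 else t * cos t / sin t.

Lemma xcot_neq0 (t : R) : t <> 0 -> xcot t = t * cos t / sin t.
Proof. intros Ht; unfold xcot; destruct (Req_EM_T t 0); tauto. Qed.

Lemma sin_neq0 (t : R) : - PI < t < PI -> t <> 0 -> sin t <> 0.
Proof.
  intros Ht H0; destruct (Rtotal_order t 0) as [H | [H | H]]; [| tauto |].
  - pose proof (sin_gt_0 (- t)) as P; rewrite sin_neg in P; lra.
  - pose proof (sin_gt_0 t); lra.
Qed.

Lemma locally_open (a b x : R) (P : R -> Prop) :
  a < x < b -> (forall y, a < y < b -> P y) -> locally x P.
Proof.
  intros Hx HP.
  apply (locally_interval P x a b); simpl; try lra.
  intros y H1 H2; apply HP; simpl in *; lra.
Qed.

Lemma xcot_continuous (t : R) : - PI < t < PI -> continuous xcot t.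
Proof.
  intros Ht; destruct (Req_dec t 0) as [-> | H0].
  - apply continuity_pt_filterlim, continuity_pt_filterlim'.
    replace (xcot 0) with 1 by (unfold xcot; destruct (Req_EM_T 0 0); tauto).
    assert (L : is_lim (fun x => cos x / (sin x / x)) 0 1).
    { replace (Finite 1) with (Rbar_div 1 1)
        by (simpl; f_equal; field).
      apply is_lim_div.
      - rewrite <- cos_0; apply is_lim_continuity.
        apply continuity_pt_filterlim, continuous_cos.
      - apply is_lim_sinc_0.
      - intros E; injection E; lra.
      - exact I. }
    apply (is_lim_ext_loc _ xcot 0 1) in L; [exact L |].
    exists (mkposreal PI PI_RGT_0); intros y Hy Hy0.
    rewrite xcot_neq0 by exact Hy0.
    field; split; auto.
    apply sin_neq0; auto.
    apply Rabs_def2 in Hy; unfold minus, plus, opp in Hy; simpl in Hy; lra.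
  - assert (L : continuous (fun s => s * cos s / sin s) t).
    { apply @ex_derive_continuous; auto_derive; repeat split.
      apply sin_neq0; auto. }
    revert L; apply continuous_ext_loc.
    destruct (Rtotal_order t 0) as [H | [H | H]]; [| tauto |].
    + apply (locally_open (-PI) 0); [lra |].
      intros y Hy; symmetry; apply xcot_neq0; lra.
    + apply (locally_open 0 PI); [lra |].
      intros y Hy; symmetry; apply xcot_neq0; lra.
Qed.

(** The open interval (-pi, pi) contains 0, so that the integral is
    differentiable on both sides of its base point. *)
Lemma is_derive_RInt_PI (f : R -> R) (x : R) :
  (forall t, - PI < t < PI -> continuous f t) ->
  - PI < x < PI -> is_derive (fun y => RInt f 0 y) x (f x).
Proof.
  intros Hf Hx; apply (is_derive_RInt f _ 0); [| auto].
  apply (locally_open (-PI) PI); [lra |].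
  intros y Hy; apply (@RInt_correct R_CompleteNormedModule).
  apply (@ex_RInt_continuous R_CompleteNormedModule).
  intros z; unfold Rmin, Rmax; destruct (Rle_dec 0 y); intros Hz; apply Hf; lra.
Qed.

Definition cotI1 (x : R) : R := RInt xcot 0 x.
Definition cotI2 (x : R) : R := RInt (fun t => t * xcot t) 0 x.

Lemma cotI1_0 : cotI1 0 = 0.
Proof. apply (@RInt_point R_CompleteNormedModule). Qed.

Lemma cotI2_0 : cotI2 0 = 0.
Proof. apply (@RInt_point R_CompleteNormedModule). Qed.

Lemma is_derive_cotI1 (x : R) :
  - PI < x < PI -> is_derive cotI1 x (xcot x).
Proof. apply is_derive_RInt_PI, xcot_continuous. Qed.

Lemma is_derive_cotI2 (x : R) :
  - PI < x < PI -> is_derive cotI2 x (x * xcot x).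
Proof.
  apply (is_derive_RInt_PI (fun t => t * xcot t)).
  intros t Ht; apply (continuous_mult (fun t => t) xcot).
  - apply continuous_id.
  - apply xcot_continuous, Ht.
Qed.

Lemma Derive_cotI1 (x : R) :
  - PI < x < PI -> Derive (fun t => cotI1 t) x = xcot x.
Proof. intros Hx; apply is_derive_unique, (is_derive_cotI1 x Hx). Qed.

Lemma Derive_cotI2 (x : R) :
  - PI < x < PI -> Derive (fun t => cotI2 t) x = x * xcot x.
Proof. intros Hx; apply is_derive_unique, (is_derive_cotI2 x Hx). Qed.

(** The match selects the integral by name: unification of one integral with
    the other would unfold both. *)
Ltac cotI_derivable :=
  repeat split;
  lazymatch goal with
  | |- ex_derive (fun t => cotI1 t) _ => eexists; apply is_derive_cotI1; lra
  | |- ex_derive (fun t => cotI2 t) _ => eexists; apply is_derive_cotI2; lra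
  | |- _ => auto
  end.

Ltac cotI_derive :=
  auto_derive;
  [ cotI_derivable
  | rewrite ?Derive_cotI1, ?Derive_cotI2 by lra;
    match goal with |- ?a = ?b => change (@eq R a b) end ].

Lemma is_derive_value (f : R -> R) (x l l' : R) :
  is_derive f x l -> l = l' -> is_derive f x l'.
Proof. intros H <-; exact H. Qed.

Lemma continuous_derive (f : R -> R) (x l : R) :
  is_derive f x l -> continuous f x.
Proof. intros H; apply (@ex_derive_continuous R_AbsRing R_NormedModule); eexists; exact H. Qed.

(** Integrating 2x cot(2x) = x cot(x) - x tan(x), where x tan(x) is
    (pi/2) tan(x) minus the value of t cot(t) at t = pi/2 - x, shows that
    c(2x)/2 - c(x) + c(pi/2 - x) - (pi/2) log cos(x) is constant, c denoting
    [cotI1].  Comparing x = 0 with x = pi/4 gives c(pi/2), with no improper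
    integral. *)
Lemma cotI1_PI2 : cotI1 (PI / 2) = PI / 2 * ln 2.
Proof.
  pose proof PI_RGT_0 as Hpi.
  pose (df := fun x : R =>
    xcot (2 * x) - xcot x - xcot (PI / 2 - x) + PI / 2 * (sin x / cos x)).
  assert (D : forall x, 0 <= x <= PI / 4 ->
    is_derive (fun x => / 2 * cotI1 (2 * x) - cotI1 x + cotI1 (PI / 2 - x)
                        - PI / 2 * ln (cos x)) x (df x)).
  { intros x Hx; unfold df.
    assert (0 < cos x) by (apply cos_gt_0; lra).
    cotI_derive.
    replace (PI / 2 + - x) with (PI / 2 - x) by ring; field; lra. }
  assert (Z : forall x, 0 < x < PI / 4 -> df x = 0).
  { intros x Hx; unfold df.
    assert (0 < cos x) by (apply cos_gt_0; lra).
    assert (0 < sin x) by (apply sin_gt_0; lra).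
    rewrite !xcot_neq0 by lra.
    rewrite cos_shift, sin_shift, sin_2a, cos_2a.
    field; lra. }
  pose proof (increment_eq _ (fun _ => 0) (fun _ => 0) 0 (PI / 4) ltac:(lra)
    (fun x Hx => is_derive_value _ _ _ _ (D x ltac:(lra)) (Z x Hx))
    (fun x _ => is_derive_const 0 x)
    (fun x Hx => continuous_derive _ _ _ (D x Hx))
    (fun x _ => continuous_const 0 x)) as E; simpl in E.
  replace (2 * (PI / 4)) with (PI / 2) in E by field.
  replace (PI / 2 - PI / 4) with (PI / 4) in E by field.
  rewrite Rmult_0_r, Rminus_0_r, cotI1_0, cos_0, ln_1, cos_PI4 in E.
  replace (1 / sqrt 2) with (/ sqrt 2) in E by (field; apply sqrt2_neq_0).
  assert (0 < sqrt 2) by (apply sqrt_lt_R0; lra).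
  rewrite ln_Rinv in E by assumption.
  assert (L : ln 2 = 2 * ln (sqrt 2)).
  { rewrite <- (sqrt_sqrt 2) at 1 by lra; rewrite ln_mult by assumption; ring. }
  rewrite L; lra.
Qed.

(** Since cot(pi - y) = - cot(y), both differences of the two sides have
    derivative 0; the value at y = pi/2 fixes the constants. *)
Lemma cotI_reflection (x : R) : 0 < x <= PI / 2 ->
  cotI1 (PI - x) = PI * ln (2 * sin x) - cotI1 x /\
  cotI2 (PI - x) = PI ^ 2 * ln (2 * sin x) - 2 * PI * cotI1 x + cotI2 x.
Proof.
  intros Hx.
  assert (Hs : forall y, x <= y <= PI / 2 -> 0 < sin y)
    by (intros y Hy; apply sin_gt_0; lra).
  assert (D1 : forall y, x <= y <= PI / 2 ->
    is_derive (fun y => cotI1 (PI - y) + cotI1 y - PI * ln (sin y)) y 0).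
  { intros y Hy; pose proof (Hs y Hy).
    cotI_derive.
    replace (PI + - y) with (PI - y) by ring.
    rewrite !xcot_neq0 by lra.
    rewrite cos_minus, sin_minus, cos_PI, sin_PI; field; lra. }
  assert (D2 : forall y, x <= y <= PI / 2 ->
    is_derive (fun y => cotI2 (PI - y) - cotI2 y + 2 * PI * cotI1 y
                        - PI ^ 2 * ln (sin y)) y 0).
  { intros y Hy; pose proof (Hs y Hy).
    cotI_derive.
    replace (PI + - y) with (PI - y) by ring.
    rewrite !xcot_neq0 by lra.
    rewrite cos_minus, sin_minus, cos_PI, sin_PI; field; lra. }
  pose proof (increment_eq _ (fun _ => 0) (fun _ => 0) x (PI / 2) ltac:(lra)
    (fun y Hy => D1 y ltac:(lra))
    (fun y _ => is_derive_const 0 y)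
    (fun y Hy => continuous_derive _ _ _ (D1 y Hy))
    (fun y _ => continuous_const 0 y)) as E1; simpl in E1.
  pose proof (increment_eq _ (fun _ => 0) (fun _ => 0) x (PI / 2) ltac:(lra)
    (fun y Hy => D2 y ltac:(lra))
    (fun y _ => is_derive_const 0 y)
    (fun y Hy => continuous_derive _ _ _ (D2 y Hy))
    (fun y _ => continuous_const 0 y)) as E2; cbv beta in E2.
  replace (PI - PI / 2) with (PI / 2) in E1, E2 by field.
  rewrite sin_PI2, ln_1, cotI1_PI2 in E1, E2.
  rewrite ln_mult by (try apply Hs; lra).
  split; lra.
Qed.

(** * The closed form of the harmonic series *)

(** The sum of the harmonic series at 4 sin(x)^2 ([PSeries_cbh_coef]). *)
Definition harmG (x : R) : R :=
  2 * cotI2 (2 * x) - 2 * cotI2 x + 8 * x * cotI1 x - 4 * x * cotI1 (2 * x).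

Definition harmG' (x : R) : R :=
  6 * (x * xcot x) + 8 * cotI1 x - 4 * cotI1 (2 * x).

Lemma is_derive_harmG (x : R) : 0 <= x < PI / 2 -> is_derive harmG x (harmG' x).
Proof.
  intros Hx; unfold harmG, harmG'; cotI_derive; ring.
Qed.

Lemma is_derive_harmG' (x : R) : 0 < x < PI / 2 ->
  is_derive harmG' x
    (12 * (x * cos x / sin x) + 8 * (x * sin x / cos x) - 6 * (x / sin x) ^ 2).
Proof.
  intros Hx; unfold harmG'.
  assert (0 < cos x) by (apply cos_gt_0; lra).
  assert (0 < sin x) by (apply sin_gt_0; lra).
  apply (is_derive_ext_loc
    (fun x => 6 * (x * (x * cos x / sin x)) + 8 * cotI1 x - 4 * cotI1 (2 * x))).
  { apply (locally_open 0 (PI / 2)); [lra |].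
    intros y Hy; rewrite xcot_neq0 by lra; reflexivity. }
  cotI_derive; [lra |].
  rewrite !xcot_neq0, sin_2a, cos_2a by lra.
  assert (E : cos x * cos x = 1 - sin x * sin x)
    by (pose proof (sin2_cos2 x) as P; unfold Rsqr in P; lra).
  field_simplify_eq; [| lra].
  replace (cos x ^ 3) with (cos x * (cos x * cos x)) by ring.
  replace (cos x ^ 2) with (cos x * cos x) by ring.
  rewrite !E; ring.
Qed.

Lemma continuous_harmG' (x : R) : 0 <= x < PI / 2 -> continuous harmG' x.
Proof.
  intros Hx.
  apply (continuous_ext (fun x => (6 * x) * xcot x + (8 * cotI1 x - 4 * cotI1 (2 * x)))).
  { intros y; unfold harmG'; apply Rminus_diag_uniq; ring. }
  apply (continuous_plus (fun x => 6 * x * xcot x)).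
  - apply (continuous_mult (fun x => 6 * x) xcot); [| apply xcot_continuous; lra].
    apply @ex_derive_continuous; auto_derive; auto.
  - apply @ex_derive_continuous; auto_derive; cotI_derivable.
Qed.

(** Here 2x = pi - x; the coefficients of [cotI1 x] and [cotI2 x] produced by
    reflection cancel exactly at x = pi/3. *)
Lemma harmG_PI3 : harmG (PI / 3) = PI ^ 2 / 3 * ln 3.
Proof.
  pose proof PI_RGT_0.
  destruct (cotI_reflection (PI / 3)) as [E1 E2]; [lra |].
  assert (L : ln (2 * sin (PI / 3)) = ln 3 / 2).
  { rewrite sin_PI3.
    replace (2 * (sqrt 3 / 2)) with (sqrt 3) by field.
    rewrite <- (sqrt_sqrt 3) at 2 by lra.
    rewrite ln_mult by (apply sqrt_lt_R0; lra); field. }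
  rewrite L in E1, E2; unfold harmG.
  replace (2 * (PI / 3)) with (PI - PI / 3) by field.
  rewrite E1, E2; field.
Qed.

(** * Power series in 4 sin(t)^2 *)

(** Up to the factor 4, the coefficients of the second derivative in t of
    sum u_k (4 sin(t)^2)^k: from sin(t)^(2k) one gets
    2k(2k-1) sin(t)^(2k-2) - 4k^2 sin(t)^(2k). *)
Definition sin_d2 (u : nat -> R) (k : nat) : R :=
  (INR k + 1) * (4 * INR k + 2) * u (S k) - INR k ^ 2 * u k.

Definition radius4 (u : nat -> R) : Prop := Rbar_le 4 (CV_radius u).

Lemma radius4_lt (u : nat -> R) (z : R) :
  radius4 u -> Rabs z < 4 -> Rbar_lt (Rabs z) (CV_radius u).
Proof. intros Hu Hz; exact (Rbar_lt_le_trans (Rabs z) 4 _ Hz Hu). Qed.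

Lemma radius4_derive (u : nat -> R) : radius4 u -> radius4 (PS_derive u).
Proof. unfold radius4; rewrite CV_radius_derive; auto. Qed.

Lemma radius4_incr (u : nat -> R) : radius4 u -> radius4 (PS_incr_1 u).
Proof. unfold radius4; rewrite CV_radius_incr_1; auto. Qed.

Lemma radius4_ex (u : nat -> R) (z : R) :
  radius4 u -> Rabs z < 4 -> ex_pseries u z.
Proof. intros; apply CV_radius_inside, radius4_lt; auto. Qed.

(** With z = 4 sin(t)^2, (dz/dt)^2 = 4z(4-z) and d^2z/dt^2 = 4(2-z); the
    coefficients of z^2 u'' + z u' are k^2 u_k and those of 4 z u'' + 2 u' are
    (k+1)(4k+2) u_(k+1). *)
Lemma PSeries_sin_d2 (u : nat -> R) (z : R) : radius4 u -> Rabs z < 4 ->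
  PSeries (sin_d2 u) z =
  z * (4 - z) * PSeries (PS_derive (PS_derive u)) z
  + (2 - z) * PSeries (PS_derive u) z.
Proof.
  intros Hu Hz.
  pose proof (radius4_derive u Hu) as H1.
  pose proof (radius4_derive _ H1) as H2.
  rewrite (PSeries_ext (sin_d2 u)
    (PS_minus
      (PS_plus (PS_scal 4 (PS_incr_1 (PS_derive (PS_derive u))))
               (PS_scal 2 (PS_derive u)))
      (PS_plus (PS_incr_1 (PS_incr_1 (PS_derive (PS_derive u))))
               (PS_incr_1 (PS_derive u))))).
  - rewrite PSeries_minus, !PSeries_plus, !PSeries_scal, !PSeries_incr_1.
    + ring.
    + apply radius4_ex; auto using radius4_incr.
    + apply radius4_ex; auto using radius4_incr.
    + apply @ex_pseries_scal; [apply Rmult_comm |].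
      apply radius4_ex; auto using radius4_incr.
    + apply @ex_pseries_scal; [apply Rmult_comm |].
      apply radius4_ex; auto.
    + apply @ex_pseries_plus; (apply @ex_pseries_scal; [apply Rmult_comm |]);
        apply radius4_ex; auto using radius4_incr.
    + apply @ex_pseries_plus; apply radius4_ex; auto using radius4_incr.
  - intros n; unfold sin_d2, PS_minus, PS_opp, PS_plus, PS_scal, PS_derive.
    unfold plus, opp, scal; cbn -[INR]; unfold mult; cbn -[INR].
    destruct n as [| [| n]]; cbn -[INR]; unfold zero; cbn -[INR];
      rewrite ?S_INR, ?INR_0; ring.
Qed.

Lemma sin2_bound (t : R) : - (PI / 2) < t < PI / 2 -> Rabs (4 * sin t ^ 2) < 4.
Proof.
  intros Ht.
  pose proof (cos_gt_0 t ltac:(lra) ltac:(lra)).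
  pose proof (sin2_cos2 t) as P; unfold Rsqr in P.
  apply Rabs_def1; nra.
Qed.

Lemma is_derive_PSeries_sin (u : nat -> R) (t : R) :
  radius4 u -> - (PI / 2) < t < PI / 2 ->
  is_derive (fun t => PSeries u (4 * sin t ^ 2)) t
    (8 * sin t * cos t * PSeries (PS_derive u) (4 * sin t ^ 2)).
Proof.
  intros Hu Ht.
  replace (8 * sin t * cos t * PSeries (PS_derive u) (4 * sin t ^ 2))
    with (scal (8 * sin t * cos t) (PSeries (PS_derive u) (4 * sin t ^ 2)))
    by reflexivity.
  apply (is_derive_comp (PSeries u) (fun t => 4 * sin t ^ 2)).
  - apply is_derive_PSeries, radius4_lt, sin2_bound; auto.
  - auto_derive; auto; ring.
Qed.

Lemma is_derive2_PSeries_sin (u : nat -> R) (t : R) :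
  radius4 u -> - (PI / 2) < t < PI / 2 ->
  is_derive (fun t => 8 * sin t * cos t * PSeries (PS_derive u) (4 * sin t ^ 2)) t
    (4 * PSeries (sin_d2 u) (4 * sin t ^ 2)).
Proof.
  intros Hu Ht.
  rewrite PSeries_sin_d2 by (auto using sin2_bound).
  assert (E : cos t ^ 2 = 1 - sin t ^ 2)
    by (pose proof (sin2_cos2 t) as P; unfold Rsqr in P; lra).
  eapply is_derive_value.
  - apply (is_derive_mult (fun t => 8 * sin t * cos t)
      (fun t => PSeries (PS_derive u) (4 * sin t ^ 2)) t
      (8 * (cos t ^ 2 - sin t ^ 2))).
    + auto_derive; auto; ring.
    + apply is_derive_PSeries_sin; auto using radius4_derive.
    + apply Rmult_comm.
  - unfold plus, mult; simpl.
    change (sin t * (sin t * 1)) with (sin t ^ 2).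
    change (cos t * (cos t * 1)) with (cos t ^ 2).
    set (U1 := PSeries _ _); set (U2 := PSeries _ _).
    replace (8 * sin t * cos t * (8 * sin t * cos t * U2))
      with (64 * sin t ^ 2 * cos t ^ 2 * U2) by ring.
    rewrite E; ring.
Qed.

(** * The coefficients with central binomial denominators *)
Lemma radius4_bounded (u : nat -> R) (M : R) :
  (forall n, Rabs (u n * 4 ^ n) <= M) -> radius4 u.
Proof.
  intros HM; apply (proj1 (CV_radius_bounded u) 4); exists M; exact HM.
Qed.

(** Division by zero makes the coefficient of index 0 vanish
    ([cb_coef_0]), as it should: both series start at k = 1. *)
Definition cb_coef (k : nat) : R := / (INR k ^ 2 * Binomial.C (2 * k) k).

Definition cbh_coef (k : nat) : R := cb_coef k * (S1 k + 1 / (2 * INR k)).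

Lemma cb_coef_0 : cb_coef 0 = 0.
Proof. unfold cb_coef; simpl; rewrite !Rmult_0_l; apply Rinv_0. Qed.

Lemma cbh_coef_0 : cbh_coef 0 = 0.
Proof. unfold cbh_coef; rewrite cb_coef_0; ring. Qed.

Lemma C_pos (n k : nat) : 0 < Binomial.C n k.
Proof.
  unfold Binomial.C; apply Rdiv_lt_0_compat; [| apply Rmult_lt_0_compat];
    apply INR_fact_lt_0.
Qed.

Lemma central_binomial_S (k : nat) :
  (INR k + 1) * Binomial.C (2 * S k) (S k)
  = (4 * INR k + 2) * Binomial.C (2 * k) k.
Proof.
  unfold Binomial.C.
  replace (2 * S k - S k)%nat with (S k) by lia.
  replace (2 * k - k)%nat with k by lia.
  replace (2 * S k)%nat with (S (S (2 * k))) by lia.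
  rewrite !fact_simpl, !mult_INR, !S_INR, mult_INR.
  pose proof (INR_fact_neq_0 k); pose proof (pos_INR k); simpl (INR 2).
  field; lra.
Qed.

Lemma INR_S_pos (k : nat) : 0 < INR (S k).
Proof. apply lt_0_INR; lia. Qed.

Lemma cb_coef_pos (k : nat) : 0 < cb_coef (S k).
Proof.
  apply Rinv_0_lt_compat, Rmult_lt_0_compat; [| apply C_pos].
  apply pow_lt, INR_S_pos.
Qed.

Lemma cb_coef_1 : cb_coef 1 = 1 / 2.
Proof.
  unfold cb_coef; change (2 * 1)%nat with 2%nat.
  unfold Binomial.C; simpl; field.
Qed.

Lemma cb_coef_rec (k : nat) :
  (INR (S k) + 1) * (4 * INR (S k) + 2) * cb_coef (S (S k))
  = INR (S k) ^ 2 * cb_coef (S k).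
Proof.
  unfold cb_coef.
  pose proof (central_binomial_S (S k)) as E.
  pose proof (C_pos (2 * S k) (S k)) as P1.
  pose proof (C_pos (2 * S (S k)) (S (S k))) as P2.
  pose proof (INR_S_pos k).
  rewrite (S_INR (S k)).
  set (c1 := Binomial.C (2 * S k) (S k)) in *.
  set (c2 := Binomial.C (2 * S (S k)) (S (S k))) in *.
  set (x := INR (S k)) in *.
  assert (E' : c2 = (4 * x + 2) * c1 / (x + 1)) by (rewrite <- E; field; lra).
  rewrite E'; field; lra.
Qed.

(** By the recurrence, (k+1) a_(k+1) 4^(k+1) = (4k / (4k+2)) * k a_k 4^k, so
    the sequence k a_k 4^k decreases from its first value 2. *)
Lemma cb_coef_bound (k : nat) : INR (S k) * (cb_coef (S k) * 4 ^ S k) <= 2.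
Proof.
  induction k as [| k IH].
  - rewrite cb_coef_1; simpl; lra.
  - refine (Rle_trans _ _ _ _ IH).
    pose proof (cb_coef_rec k) as E.
    pose proof (cb_coef_pos k) as P; pose proof (INR_S_pos k) as Pk.
    assert (P4 : 0 < 4 ^ S k) by (apply pow_lt; lra).
    rewrite (S_INR (S k)); change (4 ^ S (S k)) with (4 * 4 ^ S k).
    set (x := INR (S k)) in *.
    replace ((x + 1) * (cb_coef (S (S k)) * (4 * 4 ^ S k)))
      with (4 * x ^ 2 / (4 * x + 2) * cb_coef (S k) * 4 ^ S k).
    + rewrite <- !Rmult_assoc.
      apply Rmult_le_compat_r; [lra |].
      apply Rmult_le_compat_r; [lra |].
      apply Rle_div_l; nra.
    + replace (4 * x ^ 2 / (4 * x + 2) * cb_coef (S k) * 4 ^ S k)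
        with (4 / (4 * x + 2) * (x ^ 2 * cb_coef (S k)) * 4 ^ S k) by (field; lra).
      rewrite <- E; field; lra.
Qed.

Lemma S1_S (k : nat) : S1 (S k) = S1 k + 1 / INR (S k).
Proof.
  unfold S1; rewrite sum_n_Sm by lia; reflexivity.
Qed.

Lemma S1_bounds (k : nat) : 0 <= S1 k <= INR k.
Proof.
  induction k as [| k IH].
  - unfold S1; rewrite sum_n_m_zero by lia; simpl; unfold zero; simpl; lra.
  - rewrite S1_S.
    assert (0 < 1 / INR (S k) <= 1); [| rewrite (S_INR k) in *; lra].
    pose proof (pos_INR k); rewrite S_INR.
    split; [apply Rdiv_lt_0_compat; lra |].
    apply Rle_div_l; lra.
Qed.

Lemma radius4_cb_coef : radius4 cb_coef.
Proof.
  apply (radius4_bounded _ 2); intros [| k].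
  - rewrite cb_coef_0, Rmult_0_l, Rabs_R0; lra.
  - pose proof (cb_coef_bound k); pose proof (cb_coef_pos k).
    assert (0 < 4 ^ S k) by (apply pow_lt; lra).
    assert (0 < cb_coef (S k) * 4 ^ S k) by (apply Rmult_lt_0_compat; lra).
    rewrite Rabs_pos_eq by lra.
    rewrite S_INR in *; pose proof (pos_INR k); nra.
Qed.

(** The factor S1 k + 1/(2k) is at most 2k, which the decay of
    [cb_coef_bound] absorbs. *)
Lemma radius4_cbh_coef : radius4 cbh_coef.
Proof.
  apply (radius4_bounded _ 4); intros [| k].
  - rewrite cbh_coef_0, Rmult_0_l, Rabs_R0; lra.
  - pose proof (cb_coef_bound k); pose proof (cb_coef_pos k).
    assert (0 < 4 ^ S k) by (apply pow_lt; lra).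
    assert (P : 0 < cb_coef (S k) * 4 ^ S k) by (apply Rmult_lt_0_compat; lra).
    pose proof (S1_bounds (S k)).
    assert (0 < 1 / (2 * INR (S k)) <= INR (S k)).
    { rewrite S_INR; pose proof (pos_INR k).
      split; [apply Rdiv_lt_0_compat; lra | apply Rle_div_l; nra]. }
    unfold cbh_coef.
    replace (cb_coef (S k) * (S1 (S k) + 1 / (2 * INR (S k))) * 4 ^ S k)
      with ((S1 (S k) + 1 / (2 * INR (S k))) * (cb_coef (S k) * 4 ^ S k)) by ring.
    rewrite Rabs_pos_eq by (apply Rmult_le_pos; lra).
    apply (Rle_trans _ (2 * INR (S k) * (cb_coef (S k) * 4 ^ S k))); [| lra].
    apply Rmult_le_compat_r; lra.
Qed.

Lemma sin_d2_cb_coef (k : nat) :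
  sin_d2 cb_coef k = match k with O => 1 | S _ => 0 end.
Proof.
  unfold sin_d2; destruct k as [| k].
  - rewrite cb_coef_1, cb_coef_0; simpl; field.
  - rewrite cb_coef_rec; ring.
Qed.

Lemma PSeries_sin_d2_cb_coef (z : R) :
  Rabs z < 4 -> PSeries (sin_d2 cb_coef) z = 1.
Proof.
  intros Hz.
  rewrite PSeries_decr_1.
  - rewrite (PSeries_ext _ (fun _ => 0)), PSeries_const_0, sin_d2_cb_coef; [ring |].
    intros n; unfold PS_decr_1; apply sin_d2_cb_coef.
  - apply radius4_ex; [| exact Hz].
    apply (radius4_bounded _ 1); intros n; rewrite sin_d2_cb_coef.
    destruct n; simpl; rewrite ?Rmult_1_l, ?Rmult_0_l, ?Rabs_R1, ?Rabs_R0; lra.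
Qed.

(** The terms with harmonic numbers cancel by [cb_coef_rec]; what remains comes
    from h_(k+1) - h_k = 3/(2(k+1)) - 1/(2k). *)
Lemma sin_d2_cbh_coef (k : nat) :
  sin_d2 cbh_coef k = 3 * (2 * INR k + 1) * cb_coef (S k) - INR k / 2 * cb_coef k.
Proof.
  unfold sin_d2; destruct k as [| k].
  - rewrite cbh_coef_0, cb_coef_0; unfold cbh_coef, S1; rewrite sum_n_n; simpl; field.
  - pose proof (cb_coef_rec k) as E; pose proof (INR_S_pos k).
    unfold cbh_coef; rewrite (S1_S (S k)), (S_INR (S k)).
    set (x := INR (S k)) in *.
    replace (x ^ 2 * (cb_coef (S k) * (S1 (S k) + 1 / (2 * x))))
      with (x ^ 2 * cb_coef (S k) * S1 (S k) + x / 2 * cb_coef (S k)) by (field; lra).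
    rewrite <- E; field; lra.
Qed.

(** Multiplication by z aligns a_(k+1) with z^(k+1), and
    3(2k+1) = 6(k+1) - 3. *)
Lemma PSeries_sin_d2_cbh_coef (z : R) : Rabs z < 4 ->
  z * PSeries (sin_d2 cbh_coef) z =
  6 * z * PSeries (PS_derive cb_coef) z - 3 * PSeries cb_coef z
  - / 2 * z ^ 2 * PSeries (PS_derive cb_coef) z.
Proof.
  intros Hz.
  pose proof radius4_cb_coef as Ha.
  pose proof (radius4_derive _ Ha) as Hd.
  rewrite <- PSeries_incr_1.
  rewrite (PSeries_ext (PS_incr_1 (sin_d2 cbh_coef))
    (PS_minus (PS_scal 6 (PS_incr_1 (PS_derive cb_coef)))
      (PS_plus (PS_scal 3 cb_coef)
        (PS_scal (/ 2) (PS_incr_1 (PS_incr_1 (PS_derive cb_coef))))))).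
  - rewrite PSeries_minus, PSeries_plus, !PSeries_scal, !PSeries_incr_1.
    + ring.
    + apply @ex_pseries_scal; [apply Rmult_comm |].
      apply radius4_ex; auto.
    + apply @ex_pseries_scal; [apply Rmult_comm |].
      apply radius4_ex; auto using radius4_incr.
    + apply @ex_pseries_scal; [apply Rmult_comm |].
      apply radius4_ex; auto using radius4_incr.
    + apply @ex_pseries_plus; (apply @ex_pseries_scal; [apply Rmult_comm |]);
        apply radius4_ex; auto using radius4_incr.
  - intros n; unfold PS_minus, PS_opp, PS_plus, PS_scal, PS_derive.
    unfold plus, opp, scal; cbn -[INR]; unfold mult; cbn -[INR].
    destruct n as [| n]; [| destruct n as [| n]]; cbn -[INR sin_d2 cb_coef];
      unfold zero; cbn -[INR sin_d2 cb_coef].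
    + rewrite cb_coef_0; ring.
    + rewrite sin_d2_cbh_coef; simpl; field.
    + rewrite sin_d2_cbh_coef, !S_INR; field.
Qed.

(** * Summation *)

(** The second derivative of A(4 sin(t)^2) is the constant 4, and the first
    one vanishes at 0. *)
Lemma PSeries_cb_coef_derive (t : R) : 0 <= t < PI / 2 ->
  8 * sin t * cos t * PSeries (PS_derive cb_coef) (4 * sin t ^ 2) = 4 * t.
Proof.
  intros Ht.
  assert (D : forall x, 0 <= x <= t -> is_derive
    (fun t => 8 * sin t * cos t * PSeries (PS_derive cb_coef) (4 * sin t ^ 2)) x 4).
  { intros x Hx; eapply is_derive_value.
    - apply is_derive2_PSeries_sin; [apply radius4_cb_coef | lra].
    - rewrite PSeries_sin_d2_cb_coef by (apply sin2_bound; lra); ring. }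
  assert (D' : forall x, is_derive (fun t => 4 * t) x 4)
    by (intros x; auto_derive; auto; ring).
  pose proof (increment_eq _ _ (fun _ => 4) 0 t ltac:(lra)
    (fun x Hx => D x ltac:(lra)) (fun x _ => D' x)
    (fun x Hx => continuous_derive _ _ _ (D x Hx))
    (fun x _ => continuous_derive _ _ _ (D' x))) as E; cbv beta in E.
  rewrite sin_0 in E; lra.
Qed.

Lemma PSeries_cb_coef (t : R) : 0 <= t < PI / 2 ->
  PSeries cb_coef (4 * sin t ^ 2) = 2 * t ^ 2.
Proof.
  intros Ht.
  assert (D : forall x, 0 <= x <= t ->
    is_derive (fun t => PSeries cb_coef (4 * sin t ^ 2)) x (4 * x)).
  { intros x Hx; rewrite <- PSeries_cb_coef_derive by lra.
    apply is_derive_PSeries_sin; [apply radius4_cb_coef | lra]. }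
  assert (D' : forall x, is_derive (fun t => 2 * t ^ 2) x (4 * x))
    by (intros x; auto_derive; auto; ring).
  pose proof (increment_eq _ _ (fun x => 4 * x) 0 t ltac:(lra)
    (fun x Hx => D x ltac:(lra)) (fun x _ => D' x)
    (fun x Hx => continuous_derive _ _ _ (D x Hx))
    (fun x _ => continuous_derive _ _ _ (D' x))) as E; cbv beta in E.
  rewrite sin_0 in E.
  replace (4 * 0 ^ 2) with 0 in E by ring.
  rewrite PSeries_0, cb_coef_0 in E; lra.
Qed.

(** Substitute A = 2t^2 and A' = t / (2 sin(t) cos(t)) in
    [PSeries_sin_d2_cbh_coef]; dividing by z is what excludes t = 0. *)
Lemma PSeries_sin_d2_cbh_coef_sin (t : R) : 0 < t < PI / 2 ->
  4 * PSeries (sin_d2 cbh_coef) (4 * sin t ^ 2) =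
  12 * (t * cos t / sin t) + 8 * (t * sin t / cos t) - 6 * (t / sin t) ^ 2.
Proof.
  intros Ht.
  assert (0 < cos t) by (apply cos_gt_0; lra).
  assert (0 < sin t) by (apply sin_gt_0; lra).
  pose proof (PSeries_sin_d2_cbh_coef (4 * sin t ^ 2) (sin2_bound t ltac:(lra))) as E.
  pose proof (PSeries_cb_coef_derive t ltac:(lra)) as E1.
  rewrite PSeries_cb_coef in E by lra.
  set (U1 := PSeries (PS_derive cb_coef) _) in *.
  set (V := PSeries (sin_d2 cbh_coef) _) in *.
  assert (EU : U1 = t / (2 * sin t * cos t)).
  { apply (Rmult_eq_reg_l (8 * sin t * cos t)); [rewrite E1; field; lra |].
    apply Rgt_not_eq; repeat apply Rmult_lt_0_compat; lra. }
  apply (Rmult_eq_reg_l (sin t ^ 2)); [| apply Rgt_not_eq, pow_lt; lra].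
  replace (sin t ^ 2 * (4 * V)) with (4 * sin t ^ 2 * V) by ring.
  rewrite E, EU.
  assert (EC : cos t ^ 2 = 1 - sin t ^ 2)
    by (pose proof (sin2_cos2 t) as P; unfold Rsqr in P; lra).
  field_simplify_eq; [| lra].
  replace (cos t ^ 3) with (cos t * cos t ^ 2) by ring.
  rewrite ?EC; ring.
Qed.

(** The second derivatives agree for t > 0, and both first derivatives are
    continuous and vanish at 0. *)
Lemma PSeries_cbh_coef_derive (t : R) : 0 <= t < PI / 2 ->
  8 * sin t * cos t * PSeries (PS_derive cbh_coef) (4 * sin t ^ 2) = harmG' t.
Proof.
  intros Ht.
  assert (D : forall x, 0 <= x <= t -> is_derive
    (fun t => 8 * sin t * cos t * PSeries (PS_derive cbh_coef) (4 * sin t ^ 2)) x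
    (4 * PSeries (sin_d2 cbh_coef) (4 * sin x ^ 2))).
  { intros x Hx; apply is_derive2_PSeries_sin; [apply radius4_cbh_coef | lra]. }
  pose proof (increment_eq _ harmG' _ 0 t ltac:(lra)
    (fun x Hx => is_derive_value _ _ _ _ (D x ltac:(lra))
                   (PSeries_sin_d2_cbh_coef_sin x ltac:(lra)))
    (fun x Hx => is_derive_harmG' x ltac:(lra))
    (fun x Hx => continuous_derive _ _ _ (D x Hx))
    (fun x Hx => continuous_harmG' x ltac:(lra))) as E; cbv beta in E.
  unfold harmG' at 2 in E.
  rewrite sin_0, !Rmult_0_r, cotI1_0 in E; lra.
Qed.

Lemma PSeries_cbh_coef (t : R) : 0 <= t < PI / 2 ->
  PSeries cbh_coef (4 * sin t ^ 2) = harmG t.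
Proof.
  intros Ht.
  assert (D : forall x, 0 <= x <= t ->
    is_derive (fun t => PSeries cbh_coef (4 * sin t ^ 2)) x (harmG' x)).
  { intros x Hx; rewrite <- PSeries_cbh_coef_derive by lra.
    apply is_derive_PSeries_sin; [apply radius4_cbh_coef | lra]. }
  assert (D' : forall x, 0 <= x <= t -> is_derive harmG x (harmG' x))
    by (intros x Hx; apply is_derive_harmG; lra).
  pose proof (increment_eq _ _ harmG' 0 t ltac:(lra)
    (fun x Hx => D x ltac:(lra)) (fun x Hx => D' x ltac:(lra))
    (fun x Hx => continuous_derive _ _ _ (D x Hx))
    (fun x Hx => continuous_derive _ _ _ (D' x Hx))) as E; cbv beta in E.
  rewrite sin_0 in E.
  replace (4 * 0 ^ 2) with 0 in E by ring.
  unfold harmG at 2 in E.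
  rewrite PSeries_0, cbh_coef_0, !Rmult_0_r, cotI2_0 in E; lra.
Qed.

Theorem mainTheorem14 :
  is_series (fun n : nat => summand (S n)) (PI ^ 2 / 3 * ln 3).
Proof.
  pose proof PI_RGT_0.
  assert (Z : 4 * sin (PI / 3) ^ 2 = 3).
  { rewrite sin_PI3; replace (4 * (sqrt 3 / 2) ^ 2) with (sqrt 3 * sqrt 3) by field.
    apply sqrt_sqrt; lra. }
  rewrite <- harmG_PI3, <- PSeries_cbh_coef, Z by lra.
  apply (is_series_ext (fun n => cbh_coef (S n) * 3 ^ S n)).
  { intros n; unfold cbh_coef, cb_coef, summand, Rdiv; apply Rminus_diag_uniq; ring. }
  apply (is_series_incr_1 (fun n => cbh_coef n * 3 ^ n)).
  replace (plus _ _) with (PSeries cbh_coef 3)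
    by (change plus with Rplus; cbv beta; rewrite cbh_coef_0; ring).
  apply is_pseries_R, PSeries_correct, radius4_ex; [apply radius4_cbh_coef |].
  rewrite Rabs_pos_eq; lra.
Qed.
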